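(* Let $G$ be a finite simple directed graph on $n$ vertices with no vertex of in-degree zero. Set $\tau(v)=\lceil (\deg^{in}(v)+1)/2\rceil$ for every vertex $v$ of $G$. Then the smallest size of a dynamic monopoly for $(G,\tau)$ is at most $\lfloor n/2\rfloor$.
   Context: A directed graph is simple if it has no loops and there is at most one edge between any two vertices (in particular there is no directed cycle of length two). $\deg^{in}(v)$ denotes the in-degree of $v$, i.e. the number of vertices $u$ such that there is an edge from $u$ to $v$. Given a directed graph $G$ and a threshold assignment $\tau:V(G)\to\mathbb{N}$, a subset $M\subseteq V(G)$ is a dynamic monopoly (dynamo) for $(G,\tau)$ if $V(G)$ can be partitioned as $D_0\cup D_1\cup\dots\cup D_t$ with $D_0=M$ such that for every $i\ge 1$ and every $v\in D_i$, the number of edges from $D_0\cup\dots\cup D_{i-1}$ to $v$ is at least $\tau(v)$. *)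

(* Defs.v *)
From mathcomp Require Import all_boot.

Set Implicit Arguments.
Unset Strict Implicit.
Unset Printing Implicit Defensive.

(* A finite directed graph is a relation e on a finType T, where e u v means
   that there is an edge from u to v. A rel has no parallel edges, so the second
   clause leaves at most one edge between any two vertices. *)
Definition simple_digraph (T : finType) (e : rel T) : Prop :=
  (forall u, ~~ e u u) /\ (forall u v, ~~ (e u v && e v u)).

Definition indeg (T : finType) (e : rel T) (v : T) : nat := #|[set u | e u v]|.

(* The blocks D 0, ..., D t partition the vertex set; as M itself may be empty,
   blocks are allowed to be empty. *)
Definition dynamo (T : finType) (e : rel T) (tau : T -> nat) (M : {set T}) : Prop :=
  exists (t : nat) (D : 'I_t.+1 -> {set T}),
    [/\ \bigcup_(i < t.+1) D i = [set: T],
        forall i j, i != j -> [disjoint D i & D j],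
        D ord0 = M
      & forall (i : 'I_t.+1) (v : T), 0 < i -> v \in D i ->
          tau v <= #|[set u in \bigcup_(j < t.+1 | j < i) D j | e u v]| ].

Definition smallest_dynamo_size (T : finType) (e : rel T) (tau : T -> nat)
    (k : nat) : Prop :=
  (exists2 M : {set T}, dynamo e tau M & #|M| = k) /\
  (forall M : {set T}, dynamo e tau M -> k <= #|M|).

(* uphalf m is the ceiling of m / 2. *)
Definition strict_majority (T : finType) (e : rel T) (v : T) : nat :=
  uphalf (indeg e v + 1).

(* Main.v *)
(** Call a vertex set S degenerate if every nonempty X in S has a vertex v with
    fewer than deg^in(v) / 2 in-neighbours in X. The complement of a degenerate
    set is a dynamo (activate such a v first, then recurse), so it suffices to
    split V(G) into two degenerate sets: one of them has at least n/2 vertices.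

    Take a partial 2-colouring with degenerate classes and as many coloured
    vertices as possible. By maximality the in-neighbours of an uncoloured
    vertex (a hole) are all coloured, half of them in each colour. As in proofs
    of Brooks' theorem, a hole at x can be moved to any in-neighbour y of x by
    giving x the colour of y; the colouring stays optimal.

    Moving a hole backwards along a path as long as possible brings it to a
    vertex z all of whose in-neighbours lie on a path z -> q_0 -> q_1 -> ...,
    which we cut at the last in-neighbour of z. Moving the hole around the cycle
    closed by the first in-neighbour y changes the colour of no other
    in-neighbour of z, and z must stay balanced, so y has the colour of its
    predecessor on the path (which is not z, there being no 2-cycle). Moving the
    hole around the longest cycle rotates the colours of all the q_i, and after
    each rotation the same equality holds; hence the q_i all have one colour,
    contradicting that z has in-neighbours of both colours. *)

From Stdlib Require Import Classical.
Require Import Defs.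
From mathcomp Require Import all_boot.
From mathcomp Require Import zify.

(** * Least numbers and rotations of sequences *)

Lemma ex_minimal_nat (P : nat -> Prop) (m : nat) :
  P m -> exists k, [/\ P k, forall i, P i -> k <= i & k <= m].
Proof.
elim/ltn_ind: m => m IHm Pm.
have [[i Pi lt_im] | no_smaller] := classic (exists2 i, P i & i < m).
  have [k [Pk min_k le_ki]] := IHm i lt_im Pi.
  by exists k; split=> //; apply: leq_trans le_ki (ltnW lt_im).
exists m; split=> // i Pi; rewrite leqNgt; apply/negP=> lt_im.
by apply: no_smaller; exists i.
Qed.

(** Closure under [rotr 1] yields closure under all rotations, and any two adjacent entries can be
    rotated to positions [j] and [j.+1]; hence all adjacent entries agree. *)
Lemma rotr_closed_constant (A : Type) (P : seq A -> Prop) (x0 : A) (j : nat) :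
    (forall w, P w -> P (rotr 1 w)) ->
    (forall w, P w -> j.+1 < size w /\ nth x0 w j = nth x0 w j.+1) ->
  forall w, P w -> forall i, i < size w -> nth x0 w i = nth x0 w 0.
Proof.
move=> P_rotr P_eq w Pw.
have P_rot r : r <= size w -> P (rot r w).
  move=> le_rw; rewrite -[r](subKn le_rw).
  elim: (size w - r) (leq_subr r (size w)) => [|s IHs] lt_sw.
    by rewrite subn0 rot_size.
  have := P_rotr _ (IHs (ltnW lt_sw)).
  have ->: size w - s = (size w - s.+1).+1 by lia.
  rewrite -[(size w - s.+1).+1]addn1 addnC rotD; last by lia.
  by rewrite rotK.
have nth_rot r i : r + i < size w -> nth x0 (rot r w) i = nth x0 w (r + i).
  move=> lt_w; rewrite /rot nth_cat size_drop nth_drop.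
  by have ->: i < size w - r by lia.
have nth_rot_sub r i : r <= i -> i < size w ->
    nth x0 (rot (size w - r) w) i = nth x0 w (i - r).
  move=> le_ri lt_iw; rewrite /rot nth_cat size_drop nth_take; last by lia.
  have ->: (i < size w - (size w - r)) = false by lia.
  by congr (nth x0 w _); lia.
have step i : i.+1 < size w -> nth x0 w i.+1 = nth x0 w i.
  (* Rotating left by [i - j], or else right by [j - i], brings the pair at [i], [i.+1] to [j],
     [j.+1]. *)
  move=> lt_iw; have [le_ji | lt_ij] := leqP j i.
    have [] := P_eq _ (P_rot (i - j) _); first by lia.
    rewrite size_rot => lt_jw; rewrite !nth_rot; try lia.
    by rewrite addnS subnK.
  have [lt_jw _] := P_eq _ Pw.
  have [] := P_eq _ (P_rot (size w - (j - i)) _); first by lia.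
  rewrite size_rot => _; rewrite !nth_rot_sub; try lia.
  have ->: j - (j - i) = i by lia.
  by have ->: j.+1 - (j - i) = i.+1 by lia.
elim=> // i IHi lt_iw; rewrite step // IHi //; exact: ltnW.
Qed.

Section Digraph.

Context {T : finType} (e : rel T).

(** * Degenerate sets and dynamos *)

Definition indeg_from (A : {set T}) (v : T) : nat := #|[set u in A | e u v]|.

Lemma indeg_fromS (A B : {set T}) (v : T) :
  A \subset B -> indeg_from A v <= indeg_from B v.
Proof.
move=> /subsetP sAB; apply/subset_leq_card/subsetP=> u.
by rewrite !inE => /andP[/sAB-> ->].
Qed.

Lemma indeg_fromU1 (A : {set T}) (y v : T) :
  y \in A -> e y v -> indeg_from A v = (indeg_from (A :\ y) v).+1.
Proof.
move=> Ay eyv; rewrite /indeg_from (cardsD1 y) inE Ay eyv add1n; congr _.+1.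
by apply: eq_card => u; rewrite !inE andbA.
Qed.

Lemma indeg_fromD_le (A B : {set T}) (v : T) :
  [disjoint A & B] -> indeg_from A v + indeg_from B v <= indeg e v.
Proof.
move=> dAB; rewrite -cardsUI.
set I := _ :&: _; have ->: I = set0.
  apply/setP=> u; rewrite !inE; apply/negP=> /and3P[/andP[Au _] Bu _].
  by rewrite (disjointFr dAB Au) in Bu.
rewrite cards0 addn0; apply/subset_leq_card/subsetP=> u.
by rewrite !inE => /orP[]/andP[].
Qed.

Lemma indeg_fromC (A : {set T}) (v : T) :
  indeg_from A v + indeg_from (~: A) v = indeg e v.
Proof.
rewrite /indeg -[RHS](cardsID A); congr (_ + _); apply: eq_card => u.
  by rewrite !inE andbC.
by rewrite !inE.
Qed.

Definition degenerate (S : {set T}) : bool :=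
  [forall X : {set T}, (X \subset S) ==> (X != set0) ==>
     [exists v in X, 2 * indeg_from X v < indeg e v]].

Lemma degenerateP (S : {set T}) :
  reflect (forall X : {set T}, X \subset S -> X != set0 ->
             exists2 v, v \in X & 2 * indeg_from X v < indeg e v)
          (degenerate S).
Proof.
apply: (iffP forallP) => [deg X sXS nzX | deg X].
  by move: (deg X); rewrite sXS nzX => /exists_inP.
by apply/implyP=> sXS; apply/implyP=> nzX; apply/exists_inP/deg.
Qed.

Lemma degenerateS (A B : {set T}) :
  A \subset B -> degenerate B -> degenerate A.
Proof.
move=> sAB /degenerateP degB; apply/degenerateP=> X sXA.
by apply: degB; apply: subset_trans sAB.
Qed.

(** If [X] contains [x], then [x] itself is the witness: it has no loop, so its in-neighbours in [X]
    lie in [S]. *)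
Lemma degenerateU1 (S : {set T}) (x : T) :
  degenerate S -> ~~ e x x -> 2 * indeg_from S x < indeg e x ->
  degenerate (x |: S).
Proof.
move=> /degenerateP degS nexx low; apply/degenerateP=> X sXxS nzX.
have [Xx | nXx] := boolP (x \in X); last first.
  apply: degS => //; apply/subsetP=> u Xu; have := subsetP sXxS u Xu.
  by case/setU1P=> // def_u; rewrite -def_u Xu in nXx.
exists x => //; apply: leq_ltn_trans low; rewrite leq_mul2l /=.
apply/subset_leq_card/subsetP=> u; rewrite !inE => /andP[Xu eux].
rewrite eux andbT; have := subsetP sXxS u Xu.
by case/setU1P=> // def_u; rewrite def_u (negbTE nexx) in eux.
Qed.

Lemma dynamo_of_rank (tau : T -> nat) (r : T -> nat) :
    (forall v, 0 < r v -> tau v <= #|[set u | (r u < r v) && e u v]|) ->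
  dynamo e tau [set v | r v == 0].
Proof.
move=> r_tau; pose t := \max_v r v.
have le_rt v : r v < t.+1 by rewrite ltnS /t leq_bigmax.
exists t, (fun i : 'I_t.+1 => [set v | r v == i]); split=> [|i j neq_ij||i v i_gt0].
- apply/setP=> v; rewrite inE; apply/bigcupP; exists (Ordinal (le_rt v)) => //.
  by rewrite inE.
- rewrite -setI_eq0; apply/eqP/setP=> v; rewrite !inE; apply/negP.
  case/andP=> /eqP-> eq_ij; case/negP: neq_ij; exact: eq_ij.
- by [].
rewrite inE => /eqP def_i; apply: leq_trans (r_tau v _) _.
  by rewrite def_i.
apply/subset_leq_card/subsetP=> u; rewrite !inE => /andP[lt_uv ->].
rewrite andbT; apply/bigcupP; exists (Ordinal (le_rt u)); rewrite ?inE //=.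
by rewrite -def_i.
Qed.

(** The rank is an activation time, with the complement of [S] active from the start. *)
Lemma degenerate_rank (S : {set T}) :
  degenerate S ->
  exists r : T -> nat, (forall v, (r v == 0) = (v \notin S)) /\
    (forall v, 0 < r v ->
       strict_majority e v <= #|[set u | (r u < r v) && e u v]|).
Proof.
move: {2}#|S| (erefl #|S|) => n; elim: n S => [|n IHn] S card_S degS.
  exists (fun=> 0); split=> // v.
  by rewrite (cards0_eq card_S) inE.
have nzS: S != set0 by rewrite -card_gt0 card_S.
have [v Sv low_v] := degenerateP _ degS S (subxx S) nzS.
have card_Sv: #|S :\ v| = n by move: card_S; rewrite (cardsD1 v) Sv => -[].
have [r0 [r0_eq0 r0_maj]] :=
  IHn _ card_Sv (degenerateS _ _ (subD1set S v) degS).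
(* Since [v] has rank 0 for [S :\ v], it now gets rank 1. The rest of [S] moves up by one, which
   keeps every earlier in-neighbour earlier. *)
exists (fun u => if u \in S then (r0 u).+1 else 0).
split=> [u | u]; first by case: (u \in S).
have [Su _ | //] := boolP (u \in S).
have [-> | neq_uv] := eqVneq u v.
  have ->: r0 v = 0 by apply/eqP; rewrite r0_eq0 !inE eqxx.
  have -> : #|[set w | ((if w \in S then (r0 w).+1 else 0) < 1) && e w v]|
            = indeg_from (~: S) v.
    by apply: eq_card => w; rewrite !inE; case: (w \in S).
  (* Fewer than half of the in-neighbours in [S] means at least [uphalf (indeg e v + 1)] outside. *)
  have := indeg_fromC S v; rewrite /strict_majority; lia.
apply: leq_trans (r0_maj u _) _; first by rewrite lt0n r0_eq0 !inE neq_uv Su.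
apply/subset_leq_card/subsetP=> w; rewrite !inE => /andP[lt_wu ->].
by rewrite andbT; case: (w \in S); rewrite ?ltnS.
Qed.

Lemma dynamo_of_degenerate (S : {set T}) :
  degenerate S -> dynamo e (strict_majority e) (~: S).
Proof.
move=> /degenerate_rank[r [r_eq0 r_maj]].
have ->: ~: S = [set v | r v == 0] by apply/setP=> v; rewrite !inE r_eq0.
exact: dynamo_of_rank.
Qed.

(** * Optimal partial 2-colourings, with [None] for a hole *)

Definition color_class (c : {ffun T -> option bool}) (b : bool) : {set T} :=
  [set v | c v == Some b].

Definition colored (c : {ffun T -> option bool}) : nat :=
  #|[set v | c v != None]|.

Definition valid_coloring (c : {ffun T -> option bool}) : bool :=
  [forall b, degenerate (color_class c b)].

Definition optimal_coloring (c : {ffun T -> option bool}) : Prop :=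
  valid_coloring c /\ forall c', valid_coloring c' -> colored c' <= colored c.

Lemma ex_optimal_coloring : exists c, optimal_coloring c.
Proof.
have valid0: valid_coloring [ffun=> None].
  apply/forallP=> b; apply/degenerateP=> X sX0 /set0Pn[v Xv].
  by have := subsetP sX0 v Xv; rewrite inE ffunE.
exists [arg max_(c > [ffun=> None] | valid_coloring c) colored c].
by case: arg_maxnP => // c valid_c max_c; split.
Qed.

Lemma disjoint_color_class (c : {ffun T -> option bool}) :
  [disjoint color_class c true & color_class c false].
Proof.
rewrite -setI_eq0; apply/eqP/setP=> v; rewrite !inE.
by case: (c v) => [[]|].
Qed.

Definition set_color (c : {ffun T -> option bool}) (x : T) (o : option bool) :
  {ffun T -> option bool} := [ffun v => if v == x then o else c v].

Definition move_hole (c : {ffun T -> option bool}) (x y : T) :=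
  set_color (set_color c x (c y)) y None.

Hypothesis simple_e : simple_digraph e.

Lemma edge_irreflexive (x : T) : ~~ e x x.
Proof. by case: simple_e. Qed.

Lemma edge_antisym (x y : T) : e x y -> ~~ e y x.
Proof. by move=> exy; have [_ /(_ x y)] := simple_e; rewrite exy. Qed.

(** A colour on fewer than half of the in-neighbours could be given to [x], against maximality. So
    each colour takes at least half, and disjointness forces equality. *)
Lemma hole_balanced (c : {ffun T -> option bool}) (x : T) (b : bool) :
  optimal_coloring c -> c x = None ->
  2 * indeg_from (color_class c b) x = indeg e x.
Proof.
move=> [/forallP valid_c max_c] cx.
have high a : indeg e x <= 2 * indeg_from (color_class c a) x.
  rewrite leqNgt; apply/negP=> low.
  suff /max_c: valid_coloring (set_color c x (Some a)).
    rewrite leqNgt => /negP[]; apply/proper_card/properP; split.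
      by apply/subsetP=> v; rewrite !inE ffunE; case: (v == x).
    by exists x; rewrite !inE ?ffunE ?eqxx ?cx.
  apply/forallP=> a'; have [<-|neq_a] := eqVneq a a'.
    have ->: color_class (set_color c x (Some a)) a = x |: color_class c a.
      by apply/setP=> v; rewrite !inE ffunE; case: (v == x); rewrite ?eqxx.
    exact: degenerateU1 (valid_c a) (edge_irreflexive x) low.
  apply: degenerateS (valid_c a'); apply/subsetP=> v; rewrite !inE ffunE.
  have [_ /eqP[eq_a] | //] := eqVneq v x.
  by rewrite eq_a eqxx in neq_a.
have := indeg_fromD_le _ _ x (disjoint_color_class c).
have := high true; have := high false; case: b; lia.
Qed.

(** The two balanced classes already exhaust the in-degree of [x]. *)
Lemma in_neighbor_colored (c : {ffun T -> option bool}) (x y : T) :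
  optimal_coloring c -> c x = None -> e y x -> c y != None.
Proof.
move=> opt_c cx eyx; apply/negP=> /eqP cy.
have [bt bf] := (hole_balanced c x true opt_c cx, hole_balanced c x false opt_c cx).
have dis: [disjoint y |: color_class c true & color_class c false].
  rewrite -setI_eq0; apply/eqP/setP=> v; rewrite !inE.
  by have [->|_] := eqVneq v y; rewrite ?cy //; case: (c v) => [[]|].
have := indeg_fromD_le _ _ x dis.
rewrite (indeg_fromU1 _ y) ?setU11 // setU1K ?inE ?cy //; lia.
Qed.

(** Once [y] leaves its class, [x] has fewer than half of its in-neighbours there and can join it;
    the number of coloured vertices is unchanged. *)
Lemma optimal_move_hole (c : {ffun T -> option bool}) (x y : T) :
  optimal_coloring c -> c x = None -> e y x -> optimal_coloring (move_hole c x y).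
Proof.
move=> opt_c cx eyx; have cy := in_neighbor_colored c x y opt_c cx eyx.
have neq_yx: y != x by apply: contraNneq cy => ->; rewrite cx.
have [valid_c max_c] := opt_c.
have eq_colored: colored (move_hole c x y) = colored c.
  apply/eqP; rewrite /colored (cardsD1 x) [X in _ == X](cardsD1 y) !inE !ffunE.
  rewrite eqxx [x == y]eq_sym (negbTE neq_yx) cy eqn_add2l; apply/eqP/eq_card => v.
  rewrite !inE !ffunE.
  have [->|_] := eqVneq v y; first by rewrite andbF.
  by have [->|_] := eqVneq v x; rewrite ?cx.
split=> [|c' /max_c]; last by rewrite eq_colored.
apply/forallP=> b; case def_b: (c y) cy => [a|] // _.
have [<-|neq_ab] := eqVneq a b.
  have ->: color_class (move_hole c x y) a = x |: (color_class c a :\ y).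
    apply/setP=> v; rewrite !inE !ffunE.
    have [->|neq_vy] := eqVneq v y; first by rewrite (negbTE neq_yx).
    by have [_|//] := eqVneq v x; rewrite def_b eqxx.
  apply: degenerateU1 (edge_irreflexive x) _.
    by apply: degenerateS (forallP valid_c a); apply: subD1set.
  rewrite -(hole_balanced c x a opt_c cx).
  rewrite (indeg_fromU1 (color_class c a) y) ?inE ?def_b //.
  by rewrite ltn_pmul2l.
apply: degenerateS (forallP valid_c b); apply/subsetP=> v; rewrite !inE !ffunE.
have [//|_] := eqVneq v y; have [_|//] := eqVneq v x.
by rewrite def_b => /eqP[eq_ab]; rewrite eq_ab eqxx in neq_ab.
Qed.

(** * Moving holes along paths and cycles *)

Lemma move_hole_along_path (y : T) (q : seq T) (c : {ffun T -> option bool}) :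
    path e y q -> uniq (y :: q) -> optimal_coloring c -> c (last y q) = None ->
  exists c', [/\ optimal_coloring c', c' y = None,
    map c' q = map c (belast y q) & forall v, v \notin y :: q -> c' v = c v].
Proof.
elim: q y => [|w q IHq] y /=; first by move=> _ _ opt_c cy; exists c.
case/andP=> eyw path_q /andP[nyq uniq_q] opt_c c_last.
have [c1 [opt1 c1w map_c1 out_c1]] := IHq w path_q uniq_q opt_c c_last.
have neq_yw: y != w by apply: contraNneq nyq => ->; apply: mem_head.
(* The hole has reached [w]; the last move gives [w] the colour of [y], which is still the original
   one. *)
exists (move_hole c1 w y); split=> [||| v].
- exact: optimal_move_hole.
- by rewrite !ffunE eqxx.
- rewrite !ffunE eq_sym (negbTE neq_yw) eqxx (out_c1 y nyq) -map_c1.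
  congr (_ :: _); apply/eq_in_map=> v qv; rewrite !ffunE.
  have [eq_vy|_] := eqVneq v y; first by rewrite -eq_vy inE qv orbT in nyq.
  have [eq_vw|//] := eqVneq v w.
  by case/andP: uniq_q; rewrite -eq_vw qv.
rewrite inE negb_or => /andP[neq_vy nqv]; rewrite !ffunE (negbTE neq_vy).
have [eq_vw|_] := eqVneq v w; first by rewrite eq_vw mem_head in nqv.
exact: out_c1.
Qed.

(** The hole jumps from [z] to the last vertex and returns along the path. The last colour, parked
    at [z], passes to the first vertex of [q], whence the rotation. *)
Lemma rotate_hole (z : T) (q : seq T) (c : {ffun T -> option bool}) :
    q != [::] -> path e z q -> uniq (z :: q) -> e (last z q) z ->
    optimal_coloring c -> c z = None ->
  exists c', [/\ optimal_coloring c', c' z = None,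
    map c' q = rotr 1 (map c q) & forall v, v \notin q -> c' v = c v].
Proof.
case/lastP: q => // q l _ path_q uniq_q; rewrite last_rcons => elz opt_c cz.
have opt1 := optimal_move_hole c z l opt_c cz elz.
have [| c' [opt' c'z map_c' out_c']] :=
  move_hole_along_path z (rcons q l) (move_hole c z l) path_q uniq_q opt1.
  by rewrite last_rcons !ffunE eqxx.
have neq_zl: z != l.
  by apply: contraTneq elz => ->; apply: edge_irreflexive.
exists c'; split=> // [|v nqv].
  rewrite map_c' belast_rcons /= map_rcons rotr1_rcons !ffunE (negbTE neq_zl).
  rewrite eqxx; congr (_ :: _); apply/eq_in_map=> v qv; rewrite !ffunE.
  have /= := uniq_q; rewrite mem_rcons inE negb_or rcons_uniq.
  case/andP=> /andP[_ nqz] /andP[nql _].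
  have [eq_vl|_] := eqVneq v l; first by rewrite -eq_vl qv in nql.
  by have [eq_vz|//] := eqVneq v z; rewrite -eq_vz qv in nqz.
have [-> | neq_vz] := eqVneq v z; first by rewrite c'z cz.
rewrite out_c' ?inE ?negb_or ?neq_vz // !ffunE (negbTE neq_vz).
by have [eq_vl|//] := eqVneq v l; rewrite eq_vl mem_rcons mem_head in nqv.
Qed.

Lemma ex_maximal_backward_path (x : T) :
  exists z q, [/\ path e z q, uniq (z :: q), last z q = x
                & forall y, e y z -> y \in q].
Proof.
suff ext n z q : #|T| - size q = n -> path e z q -> uniq (z :: q) ->
    last z q = x -> exists z q, [/\ path e z q, uniq (z :: q), last z q = x
                                 & forall y, e y z -> y \in q].
  exact: (ext _ x [::]).
elim: n z q => [|n IHn] z q size_q path_q uniq_q last_q.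
  (* As [z :: q] is longer than [q], the measure [#|T| - size q] cannot be 0. *)
  have := max_card (mem (z :: q)); rewrite (card_uniqP uniq_q) /=.
  by rewrite -subn_gt0 size_q.
have [/'forall_implyP in_q | ] := boolP [forall y, e y z ==> (y \in q)].
  by exists z, q.
rewrite negb_forall => /existsP[y]; rewrite negb_imply => /andP[eyz nqy].
apply: (IHn y (z :: q)); rewrite /= ?eyz //; first by rewrite subnS size_q.
rewrite inE negb_or nqy andbT; apply/andP; split=> //.
by apply: contraTneq eyz => ->; apply: edge_irreflexive.
Qed.

(** Vertices are dropped from the end of [q] until an in-neighbour of [z] is met; one exists because
    the in-degree is positive. *)
Lemma ex_cycle_through_in_neighbors (z : T) (q : seq T) :
    0 < indeg e z -> path e z q -> uniq (z :: q) -> (forall y, e y z -> y \in q) ->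
  exists q', [/\ path e z q', uniq (z :: q'), e (last z q') z
               & forall y, e y z -> y \in q'].
Proof.
move=> indeg_z; elim/last_ind: q => [|q l IHq] path_q uniq_q in_q.
  by have /card_gt0P[y] := indeg_z; rewrite inE => /in_q.
have [elz | nelz] := boolP (e l z).
  by exists (rcons q l); split; rewrite ?last_rcons.
apply: IHq => [||y eyz].
- by move: path_q; rewrite rcons_path => /andP[].
- by move: uniq_q; rewrite -rcons_cons rcons_uniq => /andP[].
by have := in_q y eyz; rewrite mem_rcons inE; case: eqVneq eyz nelz => // -> ->.
Qed.

(** * Excluding holes *)

Lemma optimal_coloring_total (c : {ffun T -> option bool}) (x : T) :
  (forall v, 0 < indeg e v) -> optimal_coloring c -> c x != None.
Proof.
move=> indeg_gt0 opt_c; apply/negP=> /eqP cx.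
have [z [q0 [path_q0 uniq_q0 last_q0 in_q0]]] := ex_maximal_backward_path x.
have [| c1 [opt1 c1z _ _]] := move_hole_along_path z q0 c path_q0 uniq_q0 opt_c.
  by rewrite last_q0.
have [q [path_q uniq_q last_q in_q]] :=
  ex_cycle_through_in_neighbors z q0 (indeg_gt0 z) path_q0 uniq_q0 in_q0.
have ex_color b c2 : optimal_coloring c2 -> c2 z = None ->
    exists2 y, e y z & c2 y = Some b.
  move=> opt2 c2z; have := indeg_gt0 z.
  rewrite -(hole_balanced c2 z b opt2 c2z) muln_gt0 => /andP[_] /card_gt0P[y].
  by rewrite !inE => /andP[/eqP c2y eyz]; exists y.
have has_q : has (e^~ z) q.
  by have [y eyz _] := ex_color true c1 opt1 c1z; apply/hasP; exists y; rewrite ?in_q.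
have [y [p [p2 [def_q eyz no_p]]]] :
    exists y p p2, [/\ q = rcons p y ++ p2, e y z & ~~ has (e^~ z) p].
  by case: (split_find has_q) => y p p2; exists y, p, p2.
have [path_pq uniq_pq] := (path_q, uniq_q).
rewrite def_q in path_pq uniq_pq.
(* Position in [q] of the predecessor of [y]: [p] is nonempty, since otherwise [z] and [y] would
   form a 2-cycle. *)
pose j := (size p).-1.
have nz_p: p != [::].
  apply/eqP=> p0; move: path_pq; rewrite p0 /= => /andP[ezy _].
  by have := edge_antisym _ _ ezy; rewrite eyz.
have size_p : size p = j.+1 by rewrite /j prednK // lt0n size_eq0.
have same_color c2 : optimal_coloring c2 -> c2 z = None ->
    c2 y = c2 (nth z q j).
  move=> opt2 c2z.
  have path_p: path e z (rcons p y).
    by move: path_pq; rewrite cat_path => /andP[].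
  have uniq_p: uniq (z :: rcons p y).
    by move: uniq_pq; rewrite -cat_cons cat_uniq => /andP[].
  have [|| c3 [opt3 c3z map_c3 out_c3]] :=
    rotate_hole z (rcons p y) c2 _ path_p uniq_p _ opt2 c2z.
  - by case: (p).
  - by rewrite last_rcons.
  have c3y: c3 y = c2 (nth z q j).
    have := congr1 (fun s => nth None s (size p)) map_c3.
    rewrite map_rcons nth_rcons size_map ltnn eqxx map_rcons rotr1_rcons size_p /=.
    rewrite (nth_map z) ?size_p // => ->; rewrite def_q nth_cat size_rcons size_p.
    by rewrite ltnS leqnSn nth_rcons size_p ltnSn.
  (* Among the in-neighbours of [z] only [y] is recoloured. A change of its colour would cost the
     class [b] one in-neighbour and unbalance [z]. *)
  apply/eqP/negPn/negP => neq_c.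
  case def_b: (c2 y) (in_neighbor_colored c2 z y opt2 c2z eyz) => [b|] // _.
  have /eqP := hole_balanced c3 z b opt3 c3z.
  rewrite -(hole_balanced c2 z b opt2 c2z) eqn_mul2l /= => /eqP.
  rewrite (indeg_fromU1 (color_class c2 b) y z) ?inE ?def_b //.
  suff ->: indeg_from (color_class c3 b) z = indeg_from (color_class c2 b :\ y) z.
    lia.
  apply: eq_card => v; rewrite !inE.
  have [evz | _] := boolP (e v z); last by rewrite !andbF.
  rewrite !andbT; have [-> | neq_vy] := eqVneq v y.
    by apply/negbTE; rewrite c3y -def_b eq_sym.
  rewrite out_c3 // mem_rcons inE negb_or neq_vy; apply/negP=> pv.
  by case/hasP: no_p; exists v.
(* These colour words of [q] are closed under [rotr 1] by [rotate_hole], and [same_color] equates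
   their entries [j] and [j.+1]. *)
pose rotated w := exists2 c2, optimal_coloring c2 /\ c2 z = None & w = map c2 q.
have const_c1 : forall i, i < size (map c1 q) ->
    nth None (map c1 q) i = nth None (map c1 q) 0.
  apply: (rotr_closed_constant _ rotated None j) => [w | w|].
  - case=> c2 [opt2 c2z] ->.
    have nz_q: q != [::] by rewrite def_q; case: (p).
    have [c3 [opt3 c3z map_c3 _]] :=
      rotate_hole z q c2 nz_q path_q uniq_q last_q opt2 c2z.
    by exists c3.
  - case=> c2 [opt2 c2z] ->; rewrite size_map.
    have size_q : j.+1 < size q by rewrite def_q size_cat size_rcons size_p; lia.
    split=> //; rewrite !(nth_map z) //; last exact: ltnW.
    rewrite -same_color // def_q nth_cat size_rcons size_p ltnSn.
    by rewrite nth_rcons size_p ltnn eqxx.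
  by exists c1.
have c1_const v : v \in q -> c1 v = nth None (map c1 q) 0.
  move=> qv; rewrite -(const_c1 (index v q)) ?size_map ?index_mem //.
  by rewrite (nth_map v) ?index_mem // nth_index.
have [u euz c1u] := ex_color true c1 opt1 c1z.
have [v evz c1v] := ex_color false c1 opt1 c1z.
by have := c1_const u (in_q u euz); rewrite -(c1_const v (in_q v evz)) c1u c1v.
Qed.

Lemma ex_degenerate_bipartition :
  (forall v, 0 < indeg e v) -> exists S, degenerate S /\ degenerate (~: S).
Proof.
move=> indeg_gt0; have [c opt_c] := ex_optimal_coloring.
have /forallP valid_c := proj1 opt_c; exists (color_class c true).
split=> //; suff ->: ~: color_class c true = color_class c false by [].
apply/setP=> v; rewrite !inE.
by case: (c v) (optimal_coloring_total c v indeg_gt0 opt_c) => [[]|].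
Qed.

End Digraph.

Theorem theorem10 (T : finType) (e : rel T)
    (simple_e : simple_digraph e)
    (indeg_gt0 : forall v : T, 0 < indeg e v) :
  exists k : nat,
    smallest_dynamo_size e (strict_majority e) k /\ k <= #|T|./2.
Proof.
have [M dynM le_M] : exists2 M, dynamo e (strict_majority e) M & #|M| <= #|T|./2.
  have [S [degS degCS]] := ex_degenerate_bipartition e simple_e indeg_gt0.
  (* Both parts are dynamos, each being the complement of a degenerate set; the smaller one is
     taken. *)
  have := cardsC S; have [le_S | lt_S] := leqP #|S| #|~: S| => card_T.
    exists S; first by rewrite -(setCK S); apply: dynamo_of_degenerate.
    by rewrite -card_T; lia.
  by exists (~: S); [apply: dynamo_of_degenerate | rewrite -card_T; lia].
pose P k := exists2 M, dynamo e (strict_majority e) M & #|M| = k.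
have [|k [Pk min_k le_k]] := ex_minimal_nat P #|M|; first by exists M.
exists k; split; last exact: leq_trans le_M.
by split=> // M' dynM'; apply: min_k; exists M'.
Qed.
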